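(* There exists an absolute constant $c > 0$ such that for every integer $k \ge 2$, $$g(k) \ge c\,\frac{k^{3/2}}{(\log k)^{1/2}}.$$
   Context: All graphs are finite, simple and undirected. For a graph $G$, the repetition number $rep(G)$ is the maximum multiplicity of a value in the degree sequence of $G$, i.e. the largest number of vertices of $G$ that all have the same degree in $G$. For a positive integer $k$, $g(k)$ is the least nonnegative integer such that every graph with more than $g(k)$ vertices has an induced subgraph $H$ with $rep(H) \ge k$ (degrees being taken in $H$). This is finite by Ramsey's theorem. $\log$ is the natural logarithm. *)

(* Defs.v *)
(* Finite combinatorics: MathComp; the real bound: MathComp-Analysis. *)
From mathcomp Require Import all_boot.
From mathcomp Require Import boolp.

Set Implicit Arguments.
Unset Strict Implicit.
Unset Printing Implicit Defensive.

Record sgraph : Type := SGraph {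
  vertex :> finType;
  edge : rel vertex;
  edge_sym : symmetric edge;
  edge_irr : irreflexive edge
}.
Arguments edge {G} : rename.

Definition degree (G : sgraph) (x : G) : nat := #|[set y : G | edge x y]|.

(* Every value of the degree sequence is the degree of some vertex v, so it
   suffices to maximise the multiplicity of degree v over the vertices v. *)
Definition rep (G : sgraph) : nat :=
  \max_(v : G) #|[set x : G | degree x == degree v]|.

Section Induced.
Variables (G : sgraph) (S : {set G}).

Definition induced_edge : rel {x : G | x \in S} :=
  fun x y => edge (val x) (val y).

Fact induced_sym : symmetric induced_edge.
Proof. by move=> x y; apply: edge_sym. Qed.

Fact induced_irr : irreflexive induced_edge.
Proof. by move=> x; apply: edge_irr. Qed.

Definition induced : sgraph := SGraph induced_sym induced_irr.

End Induced.

Definition rep_bound (k m : nat) : Prop :=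
  forall G : sgraph, m < #|G| -> exists S : {set G}, k <= rep (induced S).

(* A homogeneous set of size k exists in any set of 2 ^ (k + k) vertices; this
   finite Ramsey bound makes the minimum in the definition of g exist. *)
Lemma ramsey (T : finType) (e : rel T) (e_sym : symmetric e) n s t
    (A : {set T}) :
  s + t = n -> 2 ^ n <= #|A| ->
  exists2 B : {set T}, B \subset A &
    (s <= #|B| /\ {in B &, forall x y, x != y -> e x y}) \/
    (t <= #|B| /\ {in B &, forall x y, x != y -> ~~ e x y}).
Proof.
elim: n s t A => [|n IHn] [|s] [|t] A //.
- by exists set0; [exact: sub0set | left; split=> // x y; rewrite inE].
- by exists set0; [exact: sub0set | left; split=> // x y; rewrite inE].
- by exists set0; [exact: sub0set | right; split=> // x y; rewrite inE].
move=> st_n leA.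
have /card_gt0P[v vA] : 0 < #|A| by apply: leq_trans leA; rewrite expn_gt0.
pose N := [set x in A :\ v | e v x]; pose M := [set x in A :\ v | ~~ e v x].
have cardNM : #|A| = (#|N| + #|M|).+1.
  rewrite (cardsD1 v A) vA add1n; congr _.+1.
  rewrite -(cardsID [set x | e v x] (A :\ v)).
  by congr (_ + _); apply: eq_card => x; rewrite !inE // andbC.
have sNA : N \subset A by apply/subsetP=> x; rewrite !inE => /andP[/andP[]].
have sMA : M \subset A by apply/subsetP=> x; rewrite !inE => /andP[/andP[]].
have [leN|ltN] := leqP (2 ^ n) #|N|.
  have [|B sBN [[sB cB]|[tB iB]]] := IHn s t.+1 N _ leN; first by case: st_n.
    exists (v |: B); first by rewrite subUset sub1set vA (subset_trans sBN).
    have BN x : x \in B -> (x != v) && e v x.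
      by move/(subsetP sBN); rewrite !inE => /andP[/andP[-> _] ->].
    left; split.
      by rewrite cardsU1; case: (boolP (v \in B)) => // /BN; rewrite eqxx.
    move=> x y /setU1P[->|xB] /setU1P[->|yB]; rewrite ?eqxx //.
    - by case/andP: (BN _ yB).
    - by rewrite e_sym; case/andP: (BN _ xB).
    - exact: cB.
  by exists B; [exact: subset_trans sBN sNA | right].
have leM : 2 ^ n <= #|M|.
  rewrite leqNgt; apply/negP => ltM; move: leA; rewrite cardNM expnS mul2n.
  by rewrite -addnn; apply/negP; rewrite -ltnNge -ltnS -addnS -addSn ltnS leq_add.
have [|B sBM [[sB cB]|[tB iB]]] := IHn s.+1 t M _ leM.
- by move: st_n; rewrite addnS => -[].
- by exists B; [exact: subset_trans sBM sMA | left].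
exists (v |: B); first by rewrite subUset sub1set vA (subset_trans sBM).
have BM x : x \in B -> (x != v) && ~~ e v x.
  by move/(subsetP sBM); rewrite !inE => /andP[/andP[-> _] ->].
right; split.
  by rewrite cardsU1; case: (boolP (v \in B)) => // /BM; rewrite eqxx.
move=> x y /setU1P[->|xB] /setU1P[->|yB]; rewrite ?eqxx //.
- by case/andP: (BM _ yB).
- by rewrite e_sym; case/andP: (BM _ xB).
- exact: iB.
Qed.

Lemma regular_rep (G : sgraph) d :
  (forall x : G, degree x = d) -> #|G| <= rep G.
Proof.
move=> degE; case: (posnP #|G|) => [-> //|/card_gt0P[v _]].
apply: leq_trans (leq_bigmax v); rewrite -cardsT subset_leq_card //.
by apply/subsetP=> x _; rewrite inE !degE.
Qed.

Lemma rep_bound_ex k : exists m, `[< rep_bound k m >].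
Proof.
exists (2 ^ (k + k)); apply/asboolP => G ltG.
have leG : 2 ^ (k + k) <= #|[set: G]| by rewrite cardsT ltnW.
have [B _ homB] := ramsey (@edge_sym G) erefl leG.
have leB : k <= #|B| by case: homB => -[].
exists B; apply: leq_trans leB _.
have -> : #|B| = #|induced B| by rewrite card_sig; apply: eq_card => x.
case: homB => -[_ homB].
  apply: (@regular_rep _ #|induced B|.-1) => x.
  rewrite -(cardsC1 x); apply: eq_card => y; rewrite !inE /= /induced_edge.
  have [->|yx] := eqVneq y x; first by rewrite edge_irr.
  by apply: homB; rewrite ?(valP x) ?(valP y) // (inj_eq val_inj) eq_sym.
apply: (@regular_rep _ 0) => x.
apply/eqP; rewrite cards_eq0; apply/eqP/setP => y.
rewrite !inE /= /induced_edge; have [->|yx] := eqVneq y x.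
  by rewrite edge_irr.
by apply/negbTE/homB; rewrite ?(valP x) ?(valP y) // (inj_eq val_inj) eq_sym.
Qed.

Definition g (k : nat) : nat := ex_minn (rep_bound_ex k).

Lemma gP k : rep_bound k (g k) /\ forall m, rep_bound k m -> g k <= m.
Proof.
rewrite /g; case: ex_minnP => m /asboolP km min_m.
by split=> // n kn; apply/min_m/asboolP.
Qed.

(* Main.v *)
(* Take a random graph on n vertices 0, ..., n-1 in which i and j are joined
   with probability (i + j) / 2n, so that expected degrees in any induced
   subgraph on S grow with the label.  Suppose that 3m vertices of S have the
   same degree in S; let A be the m lowest of them and B the m highest.  Then
   e(A, S) = e(B, S), although the expectations differ by at least about
   |S| m^2 / 2n.  A Chernoff bound and a union bound over all (S, A, B),
   weighted by n^-(|S| + |A| + |B|), exclude this for all S at once unless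
   m^3 <= 640 n^2 ln n. *)
Require Import Defs.
From mathcomp Require Import all_boot all_order all_algebra.
From mathcomp Require Import all_classical all_reals all_analysis.
From mathcomp Require Import ring lra zify.
Set Implicit Arguments.
Unset Strict Implicit.
Unset Printing Implicit Defensive.
Import Order.TTheory GRing.Theory Num.Theory.
Local Open Scope ring_scope.

(** * Exponential moments of independent coin tosses and a weighted union bound *)

Lemma expR_le_quadratic (R : realType) (y : R) :
  y <= 1 / 2 -> expR y <= 1 + y + 2 * y ^+ 2.
Proof.
move=> hy.
have h1 : expR y * expR (- y) = 1 by rewrite expRxMexpNx_1.
have h2 : 1 - y <= expR (- y) by rewrite expR_ge1Dx.
have h3 := expR_gt0 y.
have h4 : expR y * (1 - y) <= 1 by have := ler_wpM2l (ltW h3) h2; rewrite h1.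
have h5 : 1 <= (1 + y + 2 * y ^+ 2) * (1 - y).
  have : 0 <= y ^+ 2 * (1 - 2 * y) by rewrite mulr_ge0 ?sqr_ge0 //; lra.
  by rewrite !expr2; nra.
have h6 : 0 < 1 - y by lra.
by rewrite -(ler_pM2r h6) (le_trans h4 h5).
Qed.

(** The linear terms of the two quadratic bounds cancel, leaving [1 + 2 * p * (1 - p) * y ^+ 2];
    then [p * (1 - p) <= 1 / 4]. *)
Lemma bernoulli_mgf (R : realType) (p y : R) :
  0 <= p <= 1 -> `|y| <= 1 / 2 ->
  p * expR (y * (1 - p)) + (1 - p) * expR (y * (0 - p)) <= expR (y ^+ 2 / 2).
Proof.
move=> /andP[p0 p1]; rewrite ler_norml => /andP[y0 y1].
apply: le_trans (expR_ge1Dx _).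
have e1 : expR (y * (1 - p)) <= 1 + y * (1 - p) + 2 * (y * (1 - p)) ^+ 2.
  by apply: expR_le_quadratic; nra.
have e2 : expR (y * (0 - p)) <= 1 + y * (0 - p) + 2 * (y * (0 - p)) ^+ 2.
  by apply: expR_le_quadratic; nra.
have q0 : 0 <= 1 - p by lra.
apply: le_trans (lerD (ler_wpM2l p0 e1) (ler_wpM2l q0 e2)) _.
have h : 0 <= y ^+ 2 * (1 - 4 * (p * (1 - p))).
  rewrite mulr_ge0 ?sqr_ge0 //.
  have : 0 <= (1 - 2 * p) ^+ 2 by exact: sqr_ge0.
  by rewrite !expr2; lra.
by rewrite !expr2 in h *; lra.
Qed.

(** Probability of the outcome [f] of independent tosses; expectations become finite weighted
    sums. *)
Definition bernoulli_weight (R : realType) (P : finType) (p : P -> R)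
    (f : {ffun P -> bool}) : R :=
  \prod_e (if f e then p e else 1 - p e).

Section BernoulliProduct.
Variables (R : realType) (P : finType) (p : P -> R).
Hypothesis p01 : forall e, 0 <= p e <= 1.

Lemma bernoulli_weight_ge0 f : 0 <= bernoulli_weight p f.
Proof.
by apply: prodr_ge0 => e _; case: (f e); have /andP[] := p01 e => *; lra.
Qed.

(** Independence: expanding the product of two-term sums gives one summand per outcome. *)
Lemma bernoulli_product_sum (F : P -> bool -> R) :
  \sum_(f : {ffun P -> bool}) bernoulli_weight p f * \prod_e F e (f e) =
  \prod_e (p e * F e true + (1 - p e) * F e false).
Proof.
under [RHS]eq_bigr => e _ do
  rewrite -(big_bool +%R (fun b => (if b then p e else 1 - p e) * F e b)).
by rewrite bigA_distr_bigA; apply: eq_bigr => f _; rewrite -big_split.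
Qed.

Lemma bernoulli_weight_sum : \sum_f bernoulli_weight p f = 1.
Proof.
have := bernoulli_product_sum (fun _ _ => 1).
rewrite [RHS]big1 => [<-|e _]; last by lra.
by apply: eq_bigr => f _; rewrite big1_eq mulr1.
Qed.

Definition deviation (a : P -> R) (f : {ffun P -> bool}) : R :=
  \sum_e a e * ((f e)%:R - p e).

Lemma deviation_mgf (a : P -> R) : (forall e, `|a e| <= 1 / 2) ->
  \sum_f bernoulli_weight p f * expR (deviation a f) <=
  expR (\sum_e a e ^+ 2 / 2).
Proof.
move=> ha; rewrite expR_sum.
under [leLHS]eq_bigr => f _ do rewrite expR_sum.
rewrite (bernoulli_product_sum (fun e b => expR (a e * (b%:R - p e)))).
apply: ler_prod => e _; have /andP[p0 p1] := p01 e.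
rewrite bernoulli_mgf ?p0 // andbT.
by rewrite addr_ge0 // mulr_ge0 ?expR_ge0 //; lra.
Qed.

(** First-moment argument: the term of [t] has mean at most [q t], so some outcome keeps the sum of
    all terms below [\sum_u q u], and each term, being nonnegative, is at most that sum. *)
Lemma deviation_union_bound (I : finType) (q : I -> R) (a : I -> P -> R) :
  (forall t, 0 <= q t) -> (forall t e, `|a t e| <= 1 / 2) ->
  exists f, forall t,
    q t * expR (deviation (a t) f - \sum_e a t e ^+ 2 / 2) <= \sum_u q u.
Proof.
move=> q0 ha.
pose term t f := q t * expR (deviation (a t) f - \sum_e a t e ^+ 2 / 2).
have term0 t f : 0 <= term t f by rewrite mulr_ge0 ?expR_ge0.
have avg : \sum_f bernoulli_weight p f * (\sum_t term t f) <= \sum_u q u.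
  under eq_bigr => f _ do rewrite mulr_sumr.
  rewrite exchange_big /=; apply: ler_sum => t _.
  have -> : \sum_f bernoulli_weight p f * term t f =
      \sum_f bernoulli_weight p f * expR (deviation (a t) f) *
        (q t * expR (- \sum_e a t e ^+ 2 / 2)).
    by apply: eq_bigr => f _; rewrite /term expRD; ring.
  rewrite -mulr_suml mulrCA ler_piMr //.
  apply: le_trans (ler_wpM2r (expR_ge0 _) (deviation_mgf (ha t))) _.
  by rewrite expRxMexpNx_1.
have [f hf] : exists f, \sum_t term t f <= \sum_u q u.
  apply: contrapT => /forallNP hN.
  have {hN}gt0 f : 0 < \sum_t term t f - \sum_u q u.
    by rewrite subr_gt0 ltNge; apply/negP.
  have w0 f : 0 <= bernoulli_weight p f * (\sum_t term t f - \sum_u q u).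
    by rewrite mulr_ge0 ?bernoulli_weight_ge0 // ltW.
  have : \sum_f bernoulli_weight p f * (\sum_t term t f - \sum_u q u) <= 0.
    under eq_bigr => f _ do rewrite mulrBr.
    by rewrite sumrB -mulr_suml bernoulli_weight_sum mul1r subr_le0.
  (* Nonnegative terms with sum at most 0 all vanish; as the excesses are positive, every weight
     would be 0, against total weight 1. *)
  rewrite le_eqVlt ltNge sumr_ge0 // orbF psumr_eq0 // => /allP z.
  suff : \sum_f bernoulli_weight p f = 0.
    by rewrite bernoulli_weight_sum => /eqP; rewrite oner_eq0.
  apply: big1 => f _; have := z f (mem_index_enum f).
  by rewrite mulf_eq0 (gt_eqF (gt0 f)) orbF => /eqP.
exists f => t; apply: le_trans hf.
by rewrite -/(term t f) (bigD1 t) //= lerDl sumr_ge0.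
Qed.
End BernoulliProduct.

(** * Well-separated blocks inside a set of labels *)

Lemma nat_ivt (F : nat -> nat) n j :
  F 0%N = 0%N -> (forall t, F t.+1 <= (F t).+1)%N -> (j <= F n)%N ->
  exists t, F t = j.
Proof.
move=> F0 step; elim: n => [|n IHn] jF; first by exists 0%N; lia.
by case: (ltnP (F n) j) => Fj; [exists n.+1; have := step n; lia | exact: IHn].
Qed.

(** Raising the threshold by one admits at most one new label, so the count skips no value. *)
Lemma card_lt_threshold n (T : {set 'I_n}) j :
  (j <= #|T|)%N -> exists t : nat, #|[set x in T | (x < t)%N]| = j.
Proof.
have count0 : #|[set x in T | (x < 0)%N]| = 0%N.
  by apply: eq_card0 => x; rewrite !inE ltn0 andbF.
have countn : #|[set x in T | (x < n)%N]| = #|T|.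
  by apply: eq_card => x; rewrite !inE ltn_ord andbT.
have step t : (#|[set x in T | (x < t.+1)%N]| <=
               #|[set x in T | (x < t)%N]|.+1)%N.
  case: (ltnP t n) => tn; last first.
    apply: leqW; apply: subset_leq_card; apply/fintype.subsetP => x.
    by rewrite !inE => /andP[-> _]; apply: leq_trans tn.
  apply: (@leq_trans #|Ordinal tn |: [set x in T | (x < t)%N]|).
    apply: subset_leq_card; apply/fintype.subsetP => x; rewrite !inE.
    rewrite ltnS leq_eqVlt => /andP[-> /orP[/eqP xt|->]]; last by rewrite orbT.
    by apply/orP; left; apply/eqP/val_inj.
  by rewrite cardsU1; case: (_ \notin _); rewrite ?leqnn ?leqnSn.
by rewrite -countn; apply: nat_ivt (count0) step.
Qed.

Lemma interval_card_le n (A : {set 'I_n}) t u :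
  {in A, forall x : 'I_n, (t <= x < u)%N} -> (#|A| <= u - t)%N.
Proof.
move=> hA; rewrite -(size_iota t (u - t)) cardE -(size_map val).
apply: uniq_leq_size.
  by rewrite map_inj_uniq ?enum_uniq //; apply: val_inj.
move=> _ /mapP[x xA ->]; rewrite mem_enum in xA.
have /andP[tx xu] := hA x xA.
by rewrite mem_iota subnKC ?tx // ltnW // (leq_ltn_trans tx).
Qed.

(** Thresholds [t1], [t2], [t3] cut off the lowest [m], [2 * m] and [3 * m] labels of [T]. The
    middle block has [m] labels in [[t1, t2)], which forces [t1 + m <= t2]. *)
Lemma separated_subsets n m (T : {set 'I_n}) : (3 * m <= #|T|)%N ->
  exists A B : {set 'I_n}, [/\ A \subset T, B \subset T, #|A| = m, #|B| = m &
    {in A & B, forall a b : 'I_n, (a + m <= b)%N}].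
Proof.
move=> hT.
have [t1 h1] := @card_lt_threshold n T m ltac:(lia).
have [t2 h2] := @card_lt_threshold n T (2 * m) ltac:(lia).
have [t3 h3] := @card_lt_threshold n T (3 * m) ltac:(lia).
have diff t u : (t <= u)%N ->
    (#|[set x in T | (t <= x < u)%N]| =
     #|[set x in T | (x < u)%N]| - #|[set x in T | (x < t)%N]|)%N.
  move=> tu.
  rewrite -(cardsID [set x : 'I_n | (x < t)%N] [set x in T | (x < u)%N]).
  rewrite [X in (X + _ - _)%N](_ : _ = #|[set x in T | (x < t)%N]|).
    by rewrite addKn; apply: eq_card => x; rewrite !inE; lia.
  by apply: eq_card => x; rewrite !inE; lia.
have mono t u : (#|[set x in T | (x < t)%N]| < #|[set x in T | (x < u)%N]|)%N ->
    (t <= u)%N.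
  apply: contraTT; rewrite -leqNgt -ltnNge => ut.
  by apply: subset_leq_card; apply/fintype.subsetP => x; rewrite !inE; lia.
(* Ordering the thresholds by [mono] needs strictly increasing counts, hence [0 < m]. *)
case: (posnP m) => [m0|m0].
  exists finset.set0, finset.set0.
  by split; rewrite ?finset.sub0set ?cards0 // => x y; rewrite inE.
have h12 : (t1 <= t2)%N by apply: mono; lia.
have h23 : (t2 <= t3)%N by apply: mono; lia.
exists [set x in T | (x < t1)%N], [set x in T | (t2 <= x < t3)%N]; split.
- by apply/fintype.subsetP => x; rewrite inE => /andP[].
- by apply/fintype.subsetP => x; rewrite inE => /andP[].
- by [].
- by rewrite diff //; lia.
move=> a b; rewrite !inE => /andP[_ ha] /andP[_ /andP[hb _]].
have := @interval_card_le n [set x in T | (t1 <= x < t2)%N] t1 t2.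
rewrite diff // h1 h2.
have H : {in [set x in T | (t1 <= x < t2)%N],
    forall x : 'I_n, (t1 <= x < t2)%N}.
  by move=> x; rewrite inE => /andP[].
by move=> /(_ H); lia.
Qed.

(** * Repeated degrees of an induced subgraph, read in the ambient graph *)

Lemma induced_degree (G : sgraph) (S : {set G}) (x : Defs.induced S) :
  degree x = (\sum_(y in S) edge (val x) y)%N.
Proof.
rewrite /degree -(card_imset _ val_inj) -sum1_card.
rewrite [LHS]big_mkcond [RHS]big_mkcond /=.
apply: eq_bigr => y _; case: (boolP (y \in S)) => yS; last first.
  by case: ifP => // /imsetP[z _ yz]; rewrite yz (valP z) in yS.
have -> : y = val (exist (fun z => z \in S) y yS : Defs.induced S) by [].
rewrite mem_imset; last exact: val_inj.
by rewrite inE /= /induced_edge /=; case: edge.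
Qed.

(** Since [0 < k], the subgraph is nonempty and the maximum defining [rep] is attained at some
    vertex, whose degree class is [T]. *)
Lemma induced_rep (G : sgraph) (S : {set G}) k :
  (0 < k <= rep (Defs.induced S))%N ->
  exists (T : {set G}) (d : nat), [/\ T \subset S, (k <= #|T|)%N &
    {in T, forall x, (\sum_(y in S) edge x y)%N = d}].
Proof.
move=> /andP[k0 hk].
have [|v _ hv] := @eq_bigmax_cond (Defs.induced S) xpredT
  (fun v => #|[set x : Defs.induced S | degree x == degree v]|).
  rewrite lt0n; apply/eqP => c0; move: hk.
  rewrite /rep big_pred0 => [|v]; first by lia.
  by move/card0_eq: c0 => /(_ v).
exists (val @: [set x : Defs.induced S | degree x == degree v]), (degree v).
split.
- by apply/fintype.subsetP => _ /imsetP[x _ ->]; apply: valP.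
- by rewrite card_imset; [move: hk; rewrite /rep hv | apply: val_inj].
by move=> _ /imsetP[x /[!inE] /eqP <- ->]; rewrite induced_degree.
Qed.

(** * Sums over subsets and over pairs; graphs encoded by functions on pairs *)

Lemma sum_subset_pow (R : realType) (T : finType) (q : R) :
  \sum_(S : {set T}) q ^+ #|S| = (1 + q) ^+ #|T|.
Proof.
rewrite addrC -prodr_const bigA_distr; apply: eq_bigr => S _.
by rewrite -[in RHS]big_mkcond /= prodr_const.
Qed.

Section PairIndexedGraph.
Variables (n : nat) (f : {ffun 'I_n * 'I_n -> bool}).

Definition pair_edge : rel 'I_n :=
  fun i j => (i < j)%N && f (i, j) || (j < i)%N && f (j, i).

Lemma pair_edge_sym : symmetric pair_edge.
Proof. by move=> i j; rewrite /pair_edge orbC. Qed.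

Lemma pair_edge_irr : irreflexive pair_edge.
Proof. by move=> i; rewrite /pair_edge ltnn. Qed.

Definition pair_graph : sgraph := SGraph pair_edge_sym pair_edge_irr.

Lemma pair_edge_lt (i j : 'I_n) : (i < j)%N -> pair_edge i j = f (i, j).
Proof. by move=> ij; rewrite /pair_edge ij ltnNge (ltnW ij) orbF. Qed.

End PairIndexedGraph.

(** Passes from sums over the coordinates of the random graph to double sums over vertices. *)
Lemma sum_ordered_pairs (R : realType) n (h : 'I_n -> 'I_n -> R) :
  \sum_(e : 'I_n * 'I_n | (e.1 < e.2)%N) (h e.1 e.2 + h e.2 e.1) =
  \sum_i \sum_(j | j != i) h i j.
Proof.
rewrite -(pair_big_dep xpredT (fun i j : 'I_n => (i < j)%N)
  (fun i j => h i j + h j i)) /=.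
under eq_bigr => i _ do rewrite big_split.
rewrite big_split /= [X in _ + X](exchange_big_dep xpredT) //= -big_split.
apply: eq_bigr => i _ /=.
rewrite [RHS](bigID (fun j : 'I_n => (i < j)%N)) /=.
by congr (_ + _); apply: eq_bigl => j; rewrite -(inj_eq val_inj) /=; lia.
Qed.

(** * Edge discrepancy between two blocks: coefficients, variance proxy and mean *)

Section Discrepancy.
Variables (R : realType) (n : nat).
Implicit Types (S A B : {set 'I_n}) (f : {ffun 'I_n * 'I_n -> bool}).

Definition signed_ind A B (i : 'I_n) : R := (i \in A)%:R - (i \in B)%:R.

(* The coefficient of the pair e in l * (e(A, S) - e(B, S)), where e(A, S)
   counts the pairs (a, s) in A x S with a adjacent to s; an unordered pair is
   carried by the index (i, j) with i < j. *)
Definition pair_coef (l : R) S A B (e : 'I_n * 'I_n) : R :=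
  if (e.1 < e.2)%N then
    l * (signed_ind A B e.1 * (e.2 \in S)%:R +
         signed_ind A B e.2 * (e.1 \in S)%:R)
  else 0.

Definition pair_prob (e : 'I_n * 'I_n) : R := (e.1 + e.2)%:R / (2 * n%:R).

Lemma pair_prob_itv e : 0 <= pair_prob e <= 1.
Proof.
have n0 : (0 < n)%N by apply: leq_ltn_trans (ltn_ord e.1).
rewrite /pair_prob -natrM divr_ge0 ?ler0n //= ler_pdivrMr ?ltr0n ?muln_gt0 //.
by rewrite mul1r ler_nat; have := ltn_ord e.1; have := ltn_ord e.2; lia.
Qed.

Lemma signed_ind_sum A B (h : 'I_n -> R) :
  \sum_i signed_ind A B i * h i = \sum_(i in A) h i - \sum_(i in B) h i.
Proof.
rewrite [X in X - _]big_mkcond [X in _ - X]big_mkcond -sumrB.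
apply: eq_bigr => i _; rewrite /signed_ind.
by case: (i \in A); case: (i \in B) => /=; ring.
Qed.

(** The bracket in [pair_coef] lies between -2 and 2, so [l <= 1 / 4] meets the range condition of
    [bernoulli_mgf]. *)
Lemma pair_coef_norm l S A B e :
  0 <= l <= 1 / 4 -> `|pair_coef l S A B e| <= 1 / 2.
Proof.
move=> /andP[l0 l1]; rewrite /pair_coef /signed_ind ler_norml.
case: ifP => _; last by apply/andP; split; lra.
by apply/andP; split;
  case: (_ \in A); case: (_ \in A); case: (_ \in B); case: (_ \in B);
  case: (_ \in S); case: (_ \in S) => /=; lra.
Qed.

(** Uses [(u + v) ^+ 2 / 2 <= u ^+ 2 + v ^+ 2], one square for each orientation of the pair, then
    adds the diagonal. *)
Lemma pair_coef_sqr_sum l S A B :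
  \sum_e pair_coef l S A B e ^+ 2 / 2 <= l ^+ 2 * ((#|A| + #|B|) * #|S|)%:R.
Proof.
pose h i j := l ^+ 2 * (((i \in A)%:R + (i \in B)%:R) * (j \in S)%:R) : R.
have h0 i j : 0 <= h i j.
  by rewrite mulr_ge0 ?sqr_ge0 ?mulr_ge0 ?addr_ge0 ?ler0n.
have -> : l ^+ 2 * ((#|A| + #|B|) * #|S|)%:R = \sum_i \sum_j h i j.
  under eq_bigr => i _ do rewrite -mulr_sumr -mulr_sumr.
  rewrite -mulr_sumr -mulr_suml big_split natrM natrD /=.
  by rewrite -!natr_sum -!big_mkcond !sum1_card.
apply: (@le_trans _ _ (\sum_i \sum_(j | j != i) h i j)); last first.
  apply: ler_sum => i _; rewrite [leRHS](bigID (fun j => j != i)) /= lerDl.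
  exact: sumr_ge0.
rewrite -sum_ordered_pairs [leRHS]big_mkcond; apply: ler_sum => e _.
rewrite /pair_coef; case: ifP => _; last by rewrite expr0n /= mul0r.
rewrite exprMn -mulrA /h -mulrDr ler_wpM2l ?sqr_ge0 // /signed_ind.
by case: (_ \in A); case: (_ \in A); case: (_ \in B); case: (_ \in B);
  case: (_ \in S); case: (_ \in S) => /=; lra.
Qed.

(** Equal degrees and equal sizes make the actual discrepancy zero, so the deviation is minus its
    mean. *)
Lemma deviation_pair_coef l f S A B d :
  A \subset S -> B \subset S -> #|A| = #|B| ->
  {in A :|: B, forall x, \sum_(y in S) pair_edge f x y = d}%N ->
  deviation pair_prob (pair_coef l S A B) f =
  l * ((\sum_(i in B) i)%N%:R - (\sum_(i in A) i)%N%:R) *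
    (#|S|%:R - 2) / (2 * n%:R).
Proof.
move=> AS BS AB deg; rewrite /deviation.
pose F i j : R := (pair_edge f i j)%:R - pair_prob (i, j).
pose c := signed_ind A B.
transitivity (l * \sum_i \sum_(j | j != i) c i * (j \in S)%:R * F i j).
  rewrite -sum_ordered_pairs mulr_sumr [RHS]big_mkcond; apply: eq_bigr => e _.
  rewrite /pair_coef; case: ifP => [e12|_]; last by rewrite mul0r.
  rewrite /F [pair_edge f e.2 _]pair_edge_sym (pair_edge_lt _ e12).
  rewrite -surjective_pairing.
  have -> : pair_prob (e.2, e.1) = pair_prob e by rewrite /pair_prob /= addnC.
  by rewrite /c; ring.
(* This removes both the common degree [d] and the label sum of [S] from the total over rows. *)
have c1 : \sum_i c i = 0.
  under eq_bigr => i _ do rewrite -[c i]mulr1.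
  by rewrite signed_ind_sum !sumr_const AB subrr.
pose D : R := \sum_i c i * i%:R.
have DE : D = (\sum_(i in A) i)%N%:R - (\sum_(i in B) i)%N%:R.
  by rewrite /D signed_ind_sum !natr_sum.
(* Dropping the diagonal term [j = i], of probability [2 * i / (2 * n)], turns [#|S|] into
   [#|S| - 2]. *)
have row i : \sum_(j | j != i) c i * (j \in S)%:R * F i j =
    c i * d%:R - (c i * i%:R * (#|S|%:R - 2) +
      c i * \sum_(j in S) j%:R) / (2 * n%:R).
  have cS : c i * (i \in S)%:R = c i.
    rewrite /c /signed_ind.
    case: (boolP (i \in S)) => iS; first by rewrite mulr1.
    by rewrite (negbTE (contra (fintype.subsetP AS i) iS))
      (negbTE (contra (fintype.subsetP BS i) iS)) subrr mul0r.
  have cd : c i * (\sum_(y in S) pair_edge f i y)%N%:R = c i * d%:R.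
    rewrite /c /signed_ind.
    case: (boolP (i \in A :|: B)) => iAB; first by rewrite deg.
    move: iAB; rewrite !inE negb_or => /andP[/negbTE -> /negbTE ->].
    by rewrite subrr !mul0r.
  have full : \sum_j c i * (j \in S)%:R * F i j =
      c i * d%:R -
      (c i * i%:R * #|S|%:R + c i * \sum_(j in S) j%:R) / (2 * n%:R).
    rewrite -cd natr_sum.
    under [LHS]eq_bigr => j _ do rewrite -mulrA.
    rewrite -mulr_sumr -!(mulrA (c i)) -mulrDr -(mulrA (c i)) -mulrBr.
    congr (_ * _).
    rewrite -sum1_card natr_sum mulr_sumr -big_split mulr_suml -sumrB.
    rewrite [RHS]big_mkcond.
    apply: eq_bigr => j _; rewrite /F /pair_prob /= natrD mulr1.
    by case: (j \in S); rewrite ?mul1r ?mul0r.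
  move: full; rewrite (bigD1 i) //= cS => /(canRL (addKr _)) ->.
  rewrite /F pair_edge_irr /pair_prob /= natrD; field.
  by have := ltn_ord i; rewrite pnatr_eq0; lia.
rewrite (eq_bigr _ (fun i _ => row i)).
rewrite sumrB -mulr_suml c1 mul0r sub0r -mulr_suml big_split /= -mulr_suml -/D.
rewrite -mulr_suml c1 mul0r addr0 DE; ring.
Qed.

(** Summing [a + m <= b] over all of [A] times [B] gives the claim multiplied by [m], without
    matching the two sets. *)
Lemma separated_sum m A B : (0 < m)%N -> #|A| = m -> #|B| = m ->
  {in A & B, forall a b : 'I_n, (a + m <= b)%N} ->
  (\sum_(i in A) i + m ^ 2 <= \sum_(i in B) i)%N.
Proof.
move=> m0 cA cB AB; rewrite -(leq_pmul2l m0).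
have : (\sum_(a in A) \sum_(b in B) (a + m) <= \sum_(a in A) \sum_(b in B) b)%N.
  by apply: leq_sum => a aA; apply: leq_sum => b bB; apply: AB.
rewrite sum_nat_const cA; apply: leq_trans; apply: eq_leq.
under [RHS]eq_bigr => a _ do rewrite sum_nat_const cB.
by rewrite -big_distrr big_split /= sum_nat_const cA; lia.
Qed.

End Discrepancy.

(** * Balancing the Chernoff exponent against the union bound *)

Lemma half_le_ln (R : realType) n : (2 <= n)%N -> 1 / 2 <= ln (n%:R : R).
Proof.
move=> n2; rewrite -[leLHS]expRK ler_ln ?posrE ?expR_gt0 ?ltr0n ?(ltnW n2) //.
have n2' : 2 <= n%:R :> R by rewrite (ler_nat _ 2).
by apply: le_trans (expR_le_quadratic (lexx _)) _; lra.
Qed.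

(* In the application, M / 16N is the Chernoff parameter, D the gap between the
   label sums of the two sets of size M, and V the variance proxy. *)
Lemma chernoff_balance (R : realType) (M N s L D V : R) :
  0 <= M -> 0 < N -> 4 <= s -> M + M <= s -> 1 / 2 <= L -> M ^+ 2 <= D ->
  - ((s + M + M) * L) + (M / (16 * N) * D * (s - 2) / (2 * N) - V) <= 3 ->
  V <= (M / (16 * N)) ^+ 2 * ((M + M) * s) ->
  M ^+ 3 <= 640 * N ^+ 2 * L.
Proof.
move=> M0 N0 s4 sM hL hD hX hV.
have l0 : 0 <= M / (16 * N) by rewrite divr_ge0 // mulr_ge0 // ltW.
have gain : M ^+ 3 / N ^+ 2 * s / 64 <= M / (16 * N) * D * (s - 2) / (2 * N).
  have -> : M ^+ 3 / N ^+ 2 * s / 64 =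
      M / (16 * N) * M ^+ 2 * (s / 2) / (2 * N).
    by field; rewrite gt_eqF.
  apply: ler_wpM2r; first by rewrite invr_ge0 mulr_ge0 // ltW.
  apply: ler_pM (ler_wpM2l l0 hD) _; first by rewrite mulr_ge0 ?sqr_ge0.
    by clear - s4; lra.
  by clear - s4; lra.
have cost : V <= M ^+ 3 / N ^+ 2 * s / 128.
  apply: le_trans hV _; rewrite le_eqVlt; apply/orP; left; apply/eqP.
  by field; rewrite gt_eqF.
have L0 : 0 <= L by clear - hL; lra.
have hs : (s + M + M) * L <= 2 * s * L.
  by rewrite ler_wpM2r //; clear - sM; lra.
have h3 : 3 <= 3 * s * L by clear - s4 hL; nra.
(* [cost] is half of [gain], so [M ^+ 3 / N ^+ 2 * s / 128 <= 2 * s * L + 3 * s * L], and 640 is 5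
   times 128. *)
have : M ^+ 3 / N ^+ 2 * s <= 640 * L * s.
  by clear - hX gain cost hs h3; lra.
rewrite ler_pM2r; last by clear - s4; lra.
by rewrite ler_pdivrMr ?exprn_gt0 // mulrAC.
Qed.

Lemma repetition_discrepancy (R : realType) n k :
  (2 <= n)%N -> (4 <= k <= n)%N ->
  (forall G : sgraph, #|G| = n ->
     exists S : {set G}, (k <= rep (Defs.induced S))%N) ->
  ((k %/ 3) ^ 3)%:R <= 640 * n%:R ^+ 2 * ln (n%:R : R).
Proof.
move=> n2 /andP[k4 kn] repk; set m := (k %/ 3)%N.
have m0 : (0 < m)%N by rewrite /m divn_gt0; lia.
have m3k : (3 * m <= k)%N by rewrite /m; lia.
clearbody m.
have n0 : 0 < n%:R :> R by rewrite ltr0n; lia.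
have mn : m%:R <= n%:R :> R by rewrite ler_nat; lia.
(* The minimizer of 2 l^2 m |S| - l m^2 |S| / 4n, the Chernoff exponent. *)
pose l : R := m%:R / (16 * n%:R).
have l01 : 0 <= l <= 1 / 4.
  rewrite divr_ge0 ?mulr_ge0 ?ler0n //= ler_pdivrMr; last by rewrite mulr_gt0.
  by apply: le_trans mn _; lra.
pose I := ({set 'I_n} * {set 'I_n} * {set 'I_n})%type.
(* Charging [1 / n] per element keeps the total weight at [(1 + 1 / n) ^ (3 * n)], below
   [expR 3]. *)
pose q (t : I) : R := n%:R^-1 ^+ (#|t.1.1| + #|t.1.2| + #|t.2|).
have q0 t : 0 <= q t by rewrite exprn_ge0 ?invr_ge0 ?ler0n.
have sumq : \sum_t q t <= expR 3.
  have -> : \sum_t q t = (1 + n%:R^-1) ^+ n ^+ 3.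
    have e : (1 + n%:R^-1) ^+ n = \sum_(S : {set 'I_n}) n%:R^-1 ^+ #|S| :> R.
      by rewrite sum_subset_pow card_ord.
    rewrite /q.
    under [LHS]eq_bigr => t _ do rewrite !exprD.
    rewrite -(pair_bigA _ (fun (t : {set 'I_n} * {set 'I_n}) (B : {set 'I_n}) =>
      n%:R^-1 ^+ #|t.1| * n%:R^-1 ^+ #|t.2| * n%:R^-1 ^+ #|B|)) /=.
    under [LHS]eq_bigr => t _ do rewrite -mulr_sumr -e.
    rewrite -mulr_suml -(pair_bigA _ (fun S A : {set 'I_n} =>
      n%:R^-1 ^+ #|S| * n%:R^-1 ^+ #|A|)) /=.
    under [X in X * _]eq_bigr => t _ do rewrite -mulr_sumr -e.
    by rewrite -mulr_suml -e -!exprD -exprM; congr (_ ^+ _); lia.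
  have -> : expR 3 = expR n%:R^-1 ^+ n ^+ 3 :> R.
    by rewrite -!expRM_natl mulfV ?gt_eqF // mulr1.
  have i0 : 0 <= 1 + n%:R^-1 :> R by rewrite addr_ge0 ?invr_ge0 ?ler0n.
  by rewrite !lerXn2r ?nnegrE ?exprn_ge0 ?expR_ge0 ?expR_ge1Dx.
(* One outcome serves all triples, as [S], [A] and [B] are only found after the graph is fixed. *)
have [f hf] := deviation_union_bound (@pair_prob_itv R n)
  q0 (fun t e => pair_coef_norm t.1.1 t.1.2 t.2 e l01).
have [S [T [d [TS kT degT]]]] : exists (S T : {set 'I_n}) (d : nat),
    [/\ T \subset S, (k <= #|T|)%N &
        {in T, forall x, \sum_(y in S) pair_edge f x y = d}%N].
  have [|S hS] := repk (pair_graph f); first by rewrite card_ord.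
  by exists S; apply: (@induced_rep (pair_graph f)); rewrite hS; lia.
have [|A [B [AT BT cA cB AB]]] := @separated_subsets n m T; first by lia.
have AS := fintype.subset_trans AT TS.
have BS := fintype.subset_trans BT TS.
have kS := leq_trans kT (subset_leq_card TS).
have s4 : (4 <= #|S|)%N := leq_trans k4 kS.
have sm : (2 * m <= #|S|)%N.
  by apply: leq_trans (leq_trans m3k kS); rewrite leq_mul2r orbT.
have := le_trans (hf (S, A, B)) sumq; rewrite /q /= cA cB.
rewrite (@deviation_pair_coef _ _ l f S A B d) ?cA ?cB //; last first.
  by move=> x; rewrite inE => /orP[] xAB; apply: degT;
    [exact: (fintype.subsetP AT) | exact: (fintype.subsetP BT)].
have := pair_coef_sqr_sum l S A B; rewrite cA cB.
set V := \sum_e _; move=> hV.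
have := separated_sum m0 cA cB AB.
set DA := (\sum_(i in A) _)%N; set DB := (\sum_(i in B) _)%N => hD.
have q_exp : n%:R^-1 ^+ (#|S| + m + m) =
    expR (- ((#|S| + m + m)%:R * ln (n%:R : R))).
  by rewrite expRN expRM_natl lnK ?exprVn // posrE.
rewrite q_exp -expRD ler_expR => hX.
have L := half_le_ln R n2.
have s4' : 4 <= #|S|%:R :> R by rewrite (ler_nat _ 4).
have sm' : m%:R + m%:R <= #|S|%:R :> R.
  by rewrite -natrD ler_nat addnn -mul2n.
have {}hD : m%:R ^+ 2 <= DB%:R - DA%:R :> R.
  by rewrite lerBrDr -natrX -natrD ler_nat addnC.
move: hX hV; rewrite /l !natrD !natrM natrD.
exact: chernoff_balance.
Qed.

(** * From the discrepancy inequality to the lower bound on [g] *)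

Lemma rep_bound_ge k m : (0 < k)%N -> rep_bound k m -> (k <= m.+1)%N.
Proof.
move=> k0 km; pose E : rel 'I_m.+1 := fun _ _ => false.
have Es : symmetric E by [].
have Ei : irreflexive E by [].
have [|S hS] := km (SGraph Es Ei); first by rewrite /= card_ord.
have [|T [d [TS kT _]]] := @induced_rep _ S k; first by rewrite k0.
by apply: leq_trans kT _; apply: leq_trans (max_card _) _; rewrite card_ord.
Qed.

Lemma cube_le_rep_bound (R : realType) k m : (2 <= k)%N -> rep_bound k m ->
  k%:R ^+ 3 <= (400 * 200) * m.+1%:R ^+ 2 * ln (m.+1%:R : R).
Proof.
move=> k2 km; have km1 := rep_bound_ge (ltnW k2) km.
have m2 : (2 <= m.+1)%N by lia.
have L := half_le_ln R m2.
(* For [k] equal to 2 or 3 the left side is at most 27, while the right side is at least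
   [80000 * 4 / 2]. *)
case: (ltnP k 4) => k4.
  have kR : k%:R ^+ 3 <= 27 :> R.
    by rewrite -natrX ler_nat (@leq_trans (3 ^ 3)) // leq_exp2r.
  have mR : 4 <= m.+1%:R ^+ 2 :> R.
    by rewrite -natrX (ler_nat _ 4) (@leq_trans (2 ^ 2)) // leq_exp2r.
  by apply: le_trans kR _; nra.
have h := @repetition_discrepancy R m.+1 k m2.
have /h{}h : (4 <= k <= m.+1)%N by rewrite k4.
have /h{}h : forall G : sgraph, #|G| = m.+1 ->
    exists S : {set G}, (k <= rep (Defs.induced S))%N.
  by move=> G G1; apply: km; rewrite G1.
(* Equality holds at [k = 5]; the constant [400 * 200] is [5 ^ 3 * 640]. *)
have k5 : (k <= 5 * (k %/ 3))%N by lia.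
have : k%:R ^+ 3 <= 125 * ((k %/ 3) ^ 3)%:R :> R.
  rewrite -natrX -(natrM _ 125) ler_nat.
  by rewrite (@leq_trans ((5 * (k %/ 3)) ^ 3)) ?leq_exp2r // expnMn.
by move: h; lra.
Qed.

(** Squaring removes the fractional exponents, so the target can be compared with
    [cube_le_rep_bound]. *)
Lemma sqr_powR_div_powR (R : realType) k
    (x := k%:R `^ (3 / 2) / ln k%:R `^ (1 / 2) : R) :
  (2 <= k)%N -> 0 <= x /\ x ^+ 2 = k%:R ^+ 3 / ln k%:R.
Proof.
move=> k2; have L := half_le_ln R k2.
split; first exact: divr_ge0 (powR_ge0 _ _) (powR_ge0 _ _).
rewrite /x expr_div_n -!powR_mulrn ?powR_ge0 // -!powRrM.
rewrite [1 / 2 * _](_ : _ = 1); last by field.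
rewrite [3 / 2 * _](_ : _ = 3%:R); last by field.
by rewrite powR_mulrn ?ler0n // powRr1 //; lra.
Qed.

Theorem theorem1 (R : realType) :
  exists c : R, 0 < c /\
    forall k : nat, (2 <= k)%N ->
      c * (k%:R `^ (3 / 2) / ln k%:R `^ (1 / 2)) <= (g k)%:R.
Proof.
(* The proof gives [x <= 500 * N] with [N = m + 1], and [N <= 2 * m] because [m >= k - 1 >= 1]. *)
exists (1 / 1000); split; first by lra.
move=> k k2; have [km _] := gP k.
have := cube_le_rep_bound R k2 km.
move: (g k) (rep_bound_ge (ltnW k2) km) => m km1 {km}.
have L := half_le_ln R k2.
have k2' : 2 <= k%:R :> R by rewrite (ler_nat _ 2).
have [] := sqr_powR_div_powR R k2; move: (_ `^ _ / _) => x x0 x2.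
set N : R := m.+1%:R => hN.
have N2 : 2 <= N by rewrite (ler_nat _ 2); lia.
have mN : N <= 2 * m%:R.
  by rewrite /N -natrM ler_nat; lia.
suff : x <= 500 * N by clear - mN; lra.
have N0 : 0 <= N ^+ 2 by exact: sqr_ge0.
have NL : 0 <= N ^+ 2 * (ln k%:R - 1 / 2) by rewrite mulr_ge0 // subr_ge0.
have sq500 : (500 * N) ^+ 2 = 500 * 500 * N ^+ 2 by ring.
have N500 : 0 <= 500 * N by clear - N2; lra.
rewrite -(ler_sqr x0 N500).
rewrite x2 sq500 ler_pdivrMr; last by clear - L; lra.
(* The known bound involves [ln N], the target [ln k]. If [N <= k ^ 2] they differ by a factor at
   most 2; otherwise [k ^ 3 <= k ^ 4 <= N ^ 2] already suffices. *)
have [Nk|kN] := lerP N (k%:R ^+ 2).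
  have lnN : ln N <= 2 * ln k%:R.
    have k0 : 0 < k%:R :> R by clear - k2'; lra.
    by rewrite mulr_natl -lnXn // ler_ln // posrE ?exprn_gt0.
  have NlnN : N ^+ 2 * ln N <= N ^+ 2 * (2 * ln k%:R) by rewrite ler_wpM2l.
  by clear - hN NL N0 NlnN; lra.
have k4 : k%:R ^+ 3 <= k%:R ^+ 2 ^+ 2 :> R.
  by rewrite -exprM ler_weXn2l //; clear - k2'; lra.
have kN2 : k%:R ^+ 2 ^+ 2 <= N ^+ 2.
  by rewrite lerXn2r ?nnegrE ?sqr_ge0 ?ltW //; clear - N2; lra.
by clear - k4 kN2 NL N0; lra.
Qed.
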